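(* For each $n\ge1$ let $d_1^{(n)},\dots,d_n^{(n)}$ be a degree sequence of positive integers with even total degree $D=D^{(n)}=d_1^{(n)}+\cdots+d_n^{(n)}$, and let $\mathcal{G}$ be a random graph sampled from the configuration model with this degree sequence. Assume that for every $C>0$ (arbitrarily large) and every $\varepsilon>0$ (arbitrarily small), $\sum_{i=1}^n\mathbf 1\{d_i^{(n)}<C\sqrt{D^{(n)}/n}\}\le\varepsilon n$ for all $n>N(C,\varepsilon)$. Then for such $C,\varepsilon$, with probability $1-o(1)$ as $n\to\infty$, one may remove from $\mathcal{G}$ a (random) set of at most $2\varepsilon n$ vertices together with all edges adjacent to them, so that the following hold: 1. the total number of edges removed is no larger than $4\varepsilon C\sqrt{nD}$; 2. each vertex of the remaining graph has degree (in the remaining graph) larger than $C\sqrt{D^{(n)}/n}$; 3. conditionally on the degree sequence of the remaining graph, the law of the remaining graph is that of the configuration model with that degree sequence.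
   Context: Configuration model: given positive integers $d_1,\dots,d_n$ with even sum $D$, vertex $v_i$ carries $d_i$ half-edges; a uniformly random perfect matching of all $D$ half-edges is chosen, each matched pair forming an edge, giving a random multigraph (self-loops and multi-edges allowed; a self-loop contributes $2$ to the degree). *)

(* Defs.v *)
From mathcomp Require Import all_boot all_order all_algebra.
From mathcomp Require Import reals.

Set Implicit Arguments.
Unset Strict Implicit.
Unset Printing Implicit Defensive.

Import Order.TTheory GRing.Theory Num.Theory.

Local Open Scope nat_scope.

(* A multigraph on V is given by its edge multiplicities: [G [set u; v]] is the
   number of edges joining u and v, and in particular [G [set v]] is the number
   of self-loops at v (sets of any other cardinality are meant to get 0). *)
Definition multigraph (V : finType) : eqType := {ffun {set V} -> nat}.

(* The sum counts every edge at v once; the last term makes loops count twice. *)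
Definition degseq (V : finType) (G : multigraph V) : {ffun V -> nat} :=
  [ffun v => \sum_(e : {set V} | v \in e) G e + G [set v]].

Definition remaining (V : finType) (A : {set V}) : finType :=
  {v : V | v \notin A}.

Definition remove (V : finType) (A : {set V}) (G : multigraph V) :
    multigraph (remaining A) :=
  [ffun e : {set remaining A} => G [set val v | v in e]].

Definition removed_edges (V : finType) (A : {set V}) (G : multigraph V) : nat :=
  \sum_(e : {set V} | ~~ [disjoint e & A]) G e.

Definition total_degree (V : finType) (d : V -> nat) : nat := \sum_v d v.

Definition half_edge (V : finType) (d : V -> nat) : finType :=
  {v : V & 'I_(d v)}.

Definition perfect_matching (T : finType) (M : {set {set T}}) : bool :=
  partition M [set: T] && [forall p in M, #|p| == 2].

Definition matching (T : finType) : finType :=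
  {M : {set {set T}} | perfect_matching M}.

(* The configuration model with degrees d is the image of the uniform
   probability on [matching (half_edge d)] under this map. *)
Definition config_graph (V : finType) (d : V -> nat)
    (M : matching (half_edge d)) : multigraph V :=
  [ffun e : {set V} =>
    #|[set p in val M | [set tag h | h in (p : {set half_edge d})] == e]|].

Local Open Scope ring_scope.

Definition Pr (R : realType) (Omega : finType) (E : pred Omega) : R :=
  #|E|%:R / #|Omega|%:R.

Definition condPr (R : realType) (Omega : finType) (E F : pred Omega) : R :=
  Pr R (predI E F) / Pr R F.

(* Main.v *)
(* Let K = C sqrt(D/n) and let S be the complement of the K-core of the graph.
   Peeling off a vertex of current degree at most K deletes at most K edges, so
   at most K|S| edges are removed in all. On the other hand the degrees in S add
   up to at most twice the number of removed edges, and by the hypothesis applied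
   to 4C at most eps n of them are below 4K; hence 4K(|S| - eps n) <= 2K|S|, that
   is |S| <= 2 eps n. So for large n the bounds hold surely. For the conditional
   law, once the degrees in the complement of A exceed K, the event S = A depends
   only on the pairs of half-edges touching A; given those pairs the remaining
   half-edges are matched uniformly. *)
Require Import Defs.
From mathcomp Require Import all_boot all_order all_algebra.
From mathcomp Require Import ring lra.
From mathcomp Require Import reals.

Set Implicit Arguments.
Unset Strict Implicit.
Unset Printing Implicit Defensive.

Import Order.TTheory GRing.Theory Num.Theory.

(** * Perfect matchings and half-edges *)

Lemma perfect_matchingP (T : finType) (M : {set {set T}}) :
  reflect [/\ forall p, p \in M -> #|p| = 2,
              forall h, exists2 p, p \in M & h \in p
            & forall p q h, p \in M -> q \in M -> h \in p -> h \in q -> p = q]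
          (perfect_matching M).
Proof.
apply: (iffP andP) => [[/and3P[/eqP covM trM _] /forall_inP M2]|[M2 covM M1]].
  split=> [p /M2/eqP // | h | p q h pM qM hp hq].
    by have := in_setT h; rewrite -covM => /bigcupP.
  by rewrite -(def_pblock trM pM hp) (def_pblock trM qM hq).
split; last by apply/forall_inP => p /M2/eqP.
apply/and3P; split.
- apply/eqP/setP => h; rewrite inE; apply/bigcupP.
  by have [p] := covM h; exists p.
- apply/trivIsetP => p q pM qM; apply: contraNT => /pred0Pn[h /andP[hp hq]].
  by rewrite (M1 _ _ _ pM qM hp hq).
- by apply/negP => /M2; rewrite cards0.
Qed.

Lemma pair_partition_exists (T : finType) (A : {set T}) :
  ~~ odd #|A| -> exists2 Q, partition Q A & forall p, p \in Q -> #|p| = 2.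
Proof.
have [m] := ubnP #|A|; elim: m A => // m IHm A ltAm evA.
have [->|/set0Pn[x xA]] := eqVneq A set0.
  by exists set0 => [|p]; rewrite ?partition_set0 ?inE ?eqxx.
have /set0Pn[y] : A :\ x != set0.
  by apply: contraNneq evA => Ax0; rewrite (cardsD1 x) xA Ax0 cards0.
rewrite !inE => /andP[yx yA].
have xyA : [set x; y] \subset A by rewrite subUset !sub1set xA yA.
have cA : #|A| = (#|A :\: [set x; y]|).+2.
  by rewrite -(cardsID [set x; y]) (setIidPr xyA) cards2 eq_sym yx.
have [||Q partQ Q2] := IHm (A :\: [set x; y]).
- by move: ltAm; rewrite cA !ltnS => /ltnW.
- by move: evA; rewrite cA /= negbK.
exists ([set x; y] |: Q) => [|p].
  rewrite -(setID A [set x; y]) (setIidPr xyA).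
  apply: partitionU1 => //.
    by apply/set0Pn; exists x; rewrite !inE eqxx.
  by rewrite -setI_eq0 setIDA setDIl setDv set0I.
by rewrite !inE => /orP[/eqP->|/Q2//]; rewrite cards2 eq_sym yx.
Qed.

Lemma card_half_edge_in (V : finType) (d : V -> nat) (A : {set V}) :
  #|[set h : half_edge d | tag h \in A]| = \sum_(v in A) d v.
Proof.
rewrite -sum1dep_card (partition_big (fun h => tag h) (mem A)) //=.
apply: eq_bigr => v vA.
have tI : injective (fun i : 'I_(d v) => Tagged (fun v => 'I_(d v)) i : half_edge d).
  move=> i j /eqP; rewrite -tag_eqE /tag_eq /= eqxx tagged_asE => /eqP//.
rewrite sum1dep_card -[RHS]card_ord -(card_imset _ tI); apply: eq_card => -[w i].
rewrite !inE /=; apply/andP/imsetP => [[_ /eqP wv]|[j _ /(congr1 (@tag _ _))/= ->]];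
  last by rewrite vA eqxx.
by case: _ / wv i => i; exists i.
Qed.

(** Makes the sample space nonempty: with no matching, [Pr] would be 0 / 0 = 0 for every event,
    including the sure one. *)
Lemma matching_exists (V : finType) (d : V -> nat) :
  ~~ odd (total_degree d) -> (0 < #|matching (half_edge d)|)%N.
Proof.
move=> evD; have [|Q partQ Q2] := @pair_partition_exists (half_edge d) [set: _].
  suff -> : #|[set: half_edge d]| = total_degree d by [].
  rewrite /total_degree; have := card_half_edge_in d [set: V].
  under [in RHS]eq_bigl do rewrite inE.
  by move=> <-; apply: eq_card => h; rewrite !inE.
have Qm : perfect_matching Q.
  by rewrite /perfect_matching partQ; apply/forall_inP => p /Q2/eqP.
by apply/card_gt0P; exists (exist _ Q Qm).
Qed.

(** * Edges and degrees after removal, read off the matching *)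

Definition spilling (V : finType) (d : V -> nat) (M : matching (half_edge d))
    (W : {set V}) : {set {set half_edge d}} :=
  [set p in val M | ~~ (p \subset [set h : half_edge d | tag h \in W])].

(** For [v] in [W], their number is the degree of [v] in the graph induced on [W]. In this form the
    set depends on [M] only through [spilling M W], which is what the conditional law exploits. *)
Definition inner_half_edges (V : finType) (d : V -> nat)
    (M : matching (half_edge d)) (W : {set V}) (v : V) : {set half_edge d} :=
  [set h : half_edge d | tag h == v] :\: cover (spilling M W).

Lemma inner_half_edgesS (V : finType) (d : V -> nat)
    (M : matching (half_edge d)) (W W' : {set V}) (v : V) :
  W \subset W' -> inner_half_edges M W v \subset inner_half_edges M W' v.
Proof.
move=> sWW'; apply/setDS/bigcupsP => p; rewrite inE => /andP[pM pW'].
apply: bigcup_sup; rewrite inE pM; apply: contra pW' => /subset_trans->//.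
by apply/subsetP => h; rewrite !inE; apply: (subsetP sWW').
Qed.

Lemma mem_inner_half_edges (V : finType) (d : V -> nat)
    (M : matching (half_edge d)) (W : {set V}) (v : V) p h :
  p \in val M -> h \in p ->
  (h \in inner_half_edges M W v)
    = (tag h == v) && (p \subset [set h : half_edge d | tag h \in W]).
Proof.
move=> pM hp; have [_ _ M1] := perfect_matchingP _ (valP M).
rewrite !inE andbC; congr andb; apply/idP/idP => [|pW].
  apply: contraNT => pW; apply/bigcupP; exists p => //.
  by rewrite inE pM.
apply/bigcupP => -[q]; rewrite inE => /andP[qM qW] hq.
by rewrite (M1 _ _ _ pM qM hp hq) (negPf qW) in pW.
Qed.

Lemma card_sum_matching (T : finType) (M : matching T) (X : {set T}) :
  #|X| = \sum_(p in val M) #|X :&: p|.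
Proof.
have [_ covM M1] := perfect_matchingP _ (valP M).
rewrite -sum1_card.
rewrite (eq_bigr (fun h => \sum_(p in val M) (h \in p))) => [|h hX].
  rewrite exchange_big /=; apply: eq_bigr => p _.
  rewrite -big_mkcondr /= sum1dep_card.
  by apply: eq_card => h; rewrite !inE.
have [p pM hp] := covM h; rewrite (bigD1 p) //= hp big1 // => q /andP[qM qp].
by apply/eqP; rewrite eqb0; apply: contra qp => hq; apply/eqP/(M1 _ _ h).
Qed.


Lemma card_setIdE (T : finType) (A : {set T}) (P : pred T) :
  #|[set x in A | P x]| = \sum_(x in A) P x.
Proof. by rewrite -sum1dep_card big_mkcondr. Qed.

Lemma sum_eq_op (T : finType) (P : pred T) (c : T) : \sum_(i | P i) (c == i) = P c.
Proof.
case Pc: (P c); last first.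
  by rewrite big1 // => i Pi; case: eqP Pi => // <-; rewrite Pc.
by rewrite (bigD1 c) //= eqxx big1 // => i /andP[_ /negPf]; rewrite eq_sym => ->.
Qed.

(** The endpoints of the edge formed by [p], a singleton for a loop; [config_graph] counts pairs by
    this set. *)
Definition tags (V : finType) (d : V -> nat) (p : {set half_edge d}) : {set V} :=
  [set tag h | h in p].

Lemma tags_sub (V : finType) (d : V -> nat) (p : {set half_edge d}) (W : {set V}) :
  (p \subset [set h | tag h \in W]) = (tags p \subset W).
Proof. by rewrite sub_imset_pre. Qed.

(** A loop at [v] has two half-edges there, but [v] occurs only once in its endpoint set; the second
    summand corresponds to the loop term of [degseq]. *)
Lemma sum_tags (V : finType) (d : V -> nat) (p : {set half_edge d}) (v : V) :
  #|p| = 2 -> (v \in tags p) + (tags p == [set v]) = #|[set h in p | tag h == v]|.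
Proof.
move=> /eqP/cards2P[x [y [xy ->]]].
rewrite card_setIdE big_setU1 ?inE ?(negPf xy) //= big_set1.
rewrite /tags imsetU1 imset_set1 !inE (eq_sym v) (eq_sym v).
have -> : ([set tag x; tag y] == [set v]) = (tag x == v) && (tag y == v).
  by rewrite eqEsubset subUset !sub1set !inE (eq_sym v) (eq_sym v);
     do 2!case: eqP => // _.
by do 2!case: (_ == v).
Qed.

Lemma remove_configE (V : finType) (d : V -> nat) (M : matching (half_edge d))
    (A : {set V}) (e : {set remaining A}) :
  remove A (config_graph M) e = \sum_(p in val M) (tags p == val @: e).
Proof. by rewrite !ffunE card_setIdE. Qed.

(** Both sides are sums over the pairs of [M]: a pair inside [~: A] contributes its half-edges at
    [v] by [sum_tags], any other pair contributes nothing. *)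
Lemma degseq_remove (V : finType) (d : V -> nat) (M : matching (half_edge d))
    (A : {set V}) (v : remaining A) :
  degseq (remove A (config_graph M)) v = #|inner_half_edges M (~: A) (val v)|.
Proof.
have [M2 _ _] := perfect_matchingP _ (valP M).
rewrite (card_sum_matching M) ffunE remove_configE imset_set1.
rewrite (eq_bigr (fun e : {set remaining A} =>
    \sum_(p in val M) (tags p == val @: e))); last first.
  by move=> e _; exact: remove_configE.
rewrite exchange_big -big_split /=; apply: eq_bigr => p pM.
have iE : inner_half_edges M (~: A) (val v) :&: p
    = if tags p \subset ~: A then [set h in p | tag h == val v] else set0.
  apply/setP => h; rewrite inE; case hp: (h \in p); last first.
    by rewrite andbF; case: ifP; rewrite !inE ?hp.
  rewrite (mem_inner_half_edges _ _ pM hp) tags_sub andbT.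
  by case: ifP; rewrite !inE ?hp ?andbT ?andbF.
have [pA|pA] := boolP (tags p \subset ~: A); last first.
  have sub (e : {set remaining A}) : (tags p == val @: e :> {set V}) = false.
    apply: contraNF pA => /eqP ->; apply/subsetP => _ /imsetP[w _ ->].
    by rewrite inE; case: w.
  rewrite iE (negPf pA) cards0 -(imset_set1 val v) sub addn0 big1 // => e _.
  by rewrite sub.
rewrite iE pA -sum_tags ?M2//; congr addn.
(* The only set of remaining vertices with image [tags p], so the sum over [e] collapses to one
   term. *)
set e0 := [set w : remaining A | val w \in tags p].
have pe : tags p = val @: e0.
  apply/setP => w; apply/idP/imsetP => [wp|[u]]; last by rewrite inE => up ->.
  have wA : w \notin A by have := subsetP pA _ wp; rewrite inE.
  by exists (exist _ w wA); rewrite ?inE.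
rewrite (eq_bigr (fun e : {set remaining A} => e0 == e : nat)) => [|e _].
  by rewrite sum_eq_op /e0 inE.
by rewrite pe (inj_eq (imset_inj val_inj)).
Qed.

Lemma removed_edges_config (V : finType) (d : V -> nat)
    (M : matching (half_edge d)) (A : {set V}) :
  removed_edges A (config_graph M) = #|spilling M (~: A)|.
Proof.
rewrite /removed_edges card_setIdE.
rewrite (eq_bigr (fun e => \sum_(p in val M) (tags p == e))); last first.
  by move=> e _; rewrite ffunE card_setIdE.
rewrite exchange_big; apply: eq_bigr => p pM /=.
by rewrite tags_sub -disjoints_subset sum_eq_op.
Qed.

(** Each half-edge at a vertex of [A] lies in a pair leaving [~: A], and a pair holds two
    half-edges. *)
Lemma leq_sum_degrees_spilling (V : finType) (d : V -> nat)
    (M : matching (half_edge d)) (A : {set V}) :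
  (\sum_(v in A) d v <= 2 * #|spilling M (~: A)|)%N.
Proof.
have [M2 covM _] := perfect_matchingP _ (valP M).
rewrite -card_half_edge_in; apply: (@leq_trans #|cover (spilling M (~: A))|).
  apply/subset_leq_card/subsetP => h; rewrite inE => hA.
  have [p pM hp] := covM h; apply/bigcupP; exists p => //.
  rewrite inE pM; apply/subsetPn; exists h => //.
  by rewrite !inE hA.
apply: (leq_trans (leq_card_cover _)); rewrite mulnC -sum_nat_const leq_sum // => p.
by rewrite inE => /andP[/M2->].
Qed.

(** * The core and its dependence on the matching *)

Definition dense (V : finType) (d : V -> nat) (big : pred nat)
    (M : matching (half_edge d)) (W : {set V}) : bool :=
  [forall v in W, big #|inner_half_edges M W v|].

(* For [big k := K < k], this is the residue of repeatedly deleting vertices of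
   degree at most [K]. *)
Definition core (V : finType) (d : V -> nat) (big : pred nat)
    (M : matching (half_edge d)) : {set V} :=
  \bigcup_(W | dense big M W) W.

Lemma dense_sub_core (V : finType) (d : V -> nat) (big : pred nat)
    (M : matching (half_edge d)) (W : {set V}) :
  dense big M W -> W \subset core big M.
Proof. by move=> dW; apply: bigcup_sup. Qed.

(** Enlarging a set only adds inner half-edges, so for upward closed [big] density passes to unions.
    Allowing any [W] above the core shows that peeling never deletes a core vertex. *)
Lemma core_dense (V : finType) (d : V -> nat) (big : pred nat)
    (M : matching (half_edge d)) (W : {set V}) v :
  (forall k l, (k <= l)%N -> big k -> big l) ->
  core big M \subset W -> v \in core big M -> big #|inner_half_edges M W v|.
Proof.
move=> up cW /bigcupP[W1 dW1 vW1]; have := forall_inP dW1 v vW1; apply: up.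
apply/subset_leq_card/inner_half_edgesS/(subset_trans _ cW).
exact: dense_sub_core.
Qed.

Lemma spilling_setT (V : finType) (d : V -> nat) (M : matching (half_edge d)) :
  spilling M [set: V] = set0.
Proof.
apply/setP => p; rewrite !inE; apply/negP => /andP[_ /subsetPn[h _]].
by rewrite !inE.
Qed.

(** A pair that starts to leave when [v] is dropped contains a half-edge at [v] that was inner in
    [W]; sending each inner half-edge to its pair therefore reaches all the new ones. *)
Lemma spilling_setD1 (V : finType) (d : V -> nat) (M : matching (half_edge d))
    (W : {set V}) v :
  (#|spilling M (W :\ v)| <= #|spilling M W| + #|inner_half_edges M W v|)%N.
Proof.
have [_ _ M1] := perfect_matchingP _ (valP M).
(* The pair of [M] containing [h]; the default [set0] is never taken. *)
pose f h := odflt set0 [pick p in val M | h \in p].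
apply: (@leq_trans #|spilling M W :|: f @: inner_half_edges M W v|); last first.
  apply: (leq_trans (leq_card_setU _ _)); rewrite leq_add2l.
  exact: leq_imset_card.
apply/subset_leq_card/subsetP => p; rewrite !inE => /andP[pM /subsetPn[h hp]].
rewrite pM /=; case: (boolP (p \subset _)) => //= pW.
have := subsetP pW h hp; rewrite !inE => -> /=; rewrite andbT negbK => hv.
apply/imsetP; exists h; first by rewrite (mem_inner_half_edges _ _ pM hp) hv pW.
rewrite /f; case: pickP => [q /andP[qM hq]|/(_ p)]; last by rewrite hp andbT pM.
exact: (M1 _ _ h).
Qed.

Lemma spilling_sub (V : finType) (d : V -> nat) (M : matching (half_edge d))
    (W W' : {set V}) :
  W \subset W' -> spilling M W' =
    [set p in spilling M W | ~~ (p \subset [set h | tag h \in W'])].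
Proof.
move=> sWW'; apply/setP => p; rewrite !inE !tags_sub -andbA; congr andb.
by rewrite andbC; case: (boolP (tags p \subset W)) => [/subset_trans->|]; rewrite ?andbT.
Qed.

(* Enlarging [W] only concerns pairs that leave [W], so whether [W] is the core
   depends on those pairs alone. *)
Lemma core_eq_spilling (V : finType) (d : V -> nat) (big : pred nat)
    (M M' : matching (half_edge d)) (W : {set V}) :
  (forall k l, k <= l -> big k -> big l) ->
  spilling M W = spilling M' W -> core big M = W -> core big M' = W.
Proof.
move=> up eqMM' cW.
have eqin (W' : {set V}) v : W \subset W' ->
    inner_half_edges M W' v = inner_half_edges M' W' v.
  by move=> sWW'; rewrite /inner_half_edges !(spilling_sub _ sWW') eqMM'.
have sWc : W \subset core big M'.
  apply: dense_sub_core; apply/forall_inP => v vW; rewrite -eqin//.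
  by apply: (core_dense up); rewrite cW.
(* Since [core big M'] contains [W], [eqin] transfers its density back to [M]. *)
have : core big M' \subset core big M.
  apply: dense_sub_core; apply/forall_inP => v vc; rewrite eqin//; exact: (core_dense up).
by rewrite cW => scW; apply/eqP; rewrite eqEsubset scW.
Qed.

(** * Conditional law of the remaining graph *)

Lemma half_edge_embedding (T W V : finType) (f : T -> V) (g : W -> V)
    (U : {set T}) (delta : W -> nat) :
  injective g ->
  (forall w, #|[set h in U | f h == g w]| = delta w) ->
  (forall h, h \in U -> exists w, f h = g w) ->
  exists phi : half_edge delta -> T,
    [/\ injective phi, forall x, f (phi x) = g (tag x)
      & forall h, (h \in U) = (h \in codom phi)].
Proof.
(* The fibre over [g w] has [delta w] elements; numbering them gives the half-edges at [w]. *)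
move=> g_inj cardU gU; pose F w := [set h in U | f h == g w].
pose phi (x : half_edge delta) : T :=
  enum_val (cast_ord (esym (cardU (tag x))) (tagged x)).
have phiF x : phi x \in F (tag x) by exact: enum_valP.
have fphi x : f (phi x) = g (tag x) by have := phiF x; rewrite inE => /andP[_ /eqP].
exists phi; split => // [x y xy|h].
  have /g_inj : g (tag x) = g (tag y) by rewrite -!fphi xy.
  case: x y xy => [v i] [w j] /= xy vw; case: _ / vw j xy => j.
  by rewrite /phi /= => /enum_val_inj/cast_ord_inj ->.
apply/idP/codomP => [hU|[x ->]]; last by have := phiF x; rewrite inE => /andP[].
have [w fh] := gU h hU; have hF : h \in F w by rewrite inE hU fh /=.
exists (Tagged (fun w => 'I_(delta w)) (cast_ord (cardU w) (enum_rank_in hF h))).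
by rewrite /phi /= cast_ordK enum_rankK_in.
Qed.

(* The pairs leaving [~: A] being fixed, the half-edges they do not cover are
   identified with [half_edge delta], so a matching of the latter completes
   them uniquely. *)
Lemma matchings_with_spilling (V : finType) (d : V -> nat) (A : {set V})
    (delta : remaining A -> nat) (M0 : matching (half_edge d)) :
  (forall v, #|inner_half_edges M0 (~: A) (val v)| = delta v) ->
  exists f : matching (half_edge delta) -> matching (half_edge d),
    [/\ injective f,
        forall Q, remove A (config_graph (f Q)) = config_graph Q
      & forall M, (spilling M (~: A) == spilling M0 (~: A)) = (M \in codom f)].
Proof.
move=> degM0; set W := ~: A; set P := spilling M0 W.
have [M02 covM0 M01] := perfect_matchingP _ (valP M0).
have PM0 p : p \in P -> p \in val M0 by rewrite inE => /andP[].
(* The half-edges outside [cover P] all sit at remaining vertices, since a pair touching [A] belongs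
   to [P]; they are relabelled as [half_edge delta]. *)
have [|v|h|phi [phi_inj tag_phi imphi]] := @half_edge_embedding (half_edge d)
    (remaining A) V (fun h => tag h) val (~: cover P) delta.
- exact: val_inj.
- by rewrite -degM0; apply: eq_card => h; rewrite !inE andbC.
- rewrite inE => hP; suff hA : tag h \notin A by exists (exist _ (tag h) hA).
  apply: contra hP => hA; have [p pM hp] := covM0 h; apply/bigcupP; exists p => //.
  by rewrite inE pM; apply/subsetPn; exists h => //; rewrite !inE hA.
have phiP x p : p \in P -> phi x \notin p.
  move=> pP; have : phi x \in ~: cover P by rewrite imphi codom_f.
  by rewrite inE; apply: contra => xp; apply/bigcupP; exists p.
have tags_phi (q : {set half_edge delta}) : tags (phi @: q) = val @: tags q.
  by rewrite /tags -!imset_comp; apply: eq_imset => x /=; rewrite tag_phi.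
have val_W (e : {set remaining A}) : val @: e \subset W.
  by apply/subsetP => _ /imsetP[w _ ->]; rewrite inE; case: w.
have phi_img_inj : injective (fun q : {set half_edge delta} => phi @: q).
  exact: imset_inj.
pose F (Q : {set {set half_edge delta}}) : {set {set half_edge d}} :=
  P :|: [set phi @: (q : {set half_edge delta}) | q in Q].
have F_matching (Q : matching (half_edge delta)) : perfect_matching (F (val Q)).
  have [Q2 covQ Q1] := perfect_matchingP _ (valP Q).
  apply/perfect_matchingP; split.
  - move=> p /setUP[/PM0/M02//|/imsetP[q /Q2 q2 ->]].
    by rewrite card_imset.
  - move=> h; have := imphi h; rewrite inE; case: (boolP (h \in cover P)).
      by move=> /bigcupP[p pP hp] _; exists p; rewrite // inE pP.
    move=> _ /esym/codomP[x ->]; have [q qQ xq] := covQ x.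
    by exists (phi @: q); rewrite ?imset_f // inE orbC imset_f.
  - move=> p p' h /setUP[pP|/imsetP[q qQ ->]] /setUP[pP'|/imsetP[q' qQ' ->]].
    + by apply: M01; apply: PM0.
    + by move=> hp /imsetP[x _ hx]; rewrite hx (negPf (phiP x _ pP)) in hp.
    + by move=> /imsetP[x _ ->]; rewrite (negPf (phiP x _ pP')).
    + move=> /imsetP[x xq ->] /imsetP[x' xq' /phi_inj xx'].
      by rewrite (Q1 _ _ x qQ qQ' xq) // xx'.
have F_spilling (M : matching (half_edge d)) Q : val M = F Q -> spilling M W = P.
  move=> MF; apply/setP => p; rewrite inE MF; apply/andP/idP => [[]|pP].
    case/setUP => // /imsetP[q _ ->].
    by rewrite tags_sub tags_phi val_W.
  by rewrite inE pP; move: pP; rewrite inE => /andP[].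
pose f Q : matching (half_edge d) := exist _ (F (val Q)) (F_matching Q).
(* As [phi] avoids [cover P], a nonempty image is never in [P], so [Q] can be read back from
   [F Q]. *)
have F_img Q (q : {set half_edge delta}) : q != set0 -> (phi @: q \in F Q) = (q \in Q).
  case/set0Pn => x xq; rewrite inE mem_imset //; case: (boolP (_ \in P)) => // qP.
  by have := phiP x _ qP; rewrite imset_f.
have ne0 (Q : matching (half_edge delta)) q : q \in val Q -> q != set0.
  have [Q2 _ _] := perfect_matchingP _ (valP Q).
  by move=> /Q2; apply: contra_eqN => /eqP->; rewrite cards0.
exists f; split.
- move=> Q Q' /(congr1 val)/= FQ; apply/val_inj/setP => q.
  have [->|q0] := eqVneq q set0.
    by apply/idP/idP => /ne0; rewrite eqxx.
  by rewrite -!F_img // FQ.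
- move=> Q; apply/ffunP => e; rewrite remove_configE ffunE -card_setIdE.
  rewrite -(card_imset _ phi_img_inj); apply: eq_card => p; rewrite !inE.
  apply/andP/imsetP => [[/orP[pP|/imsetP[q qQ ->]] /eqP pe]|[q]].
  + by case/andP: pP => _; rewrite tags_sub pe val_W.
  + exists q => //; rewrite inE qQ; apply/eqP/(imset_inj val_inj).
    by rewrite -tags_phi.
  + rewrite inE => /andP[qQ /eqP <-] ->; rewrite imset_f ?orbT //.
    by rewrite tags_phi.
- move=> M; apply/eqP/codomP => [MP|[Q ->]]; last exact: (F_spilling _ (val Q)).
  have [M2 covM M1] := perfect_matchingP _ (valP M).
  have PM p : p \in P -> p \in val M by rewrite -MP inE => /andP[].
  (* Surjectivity: the pairs of [M] outside [P] avoid [cover P], hence lie in the image of [phi] and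
     pull back to a matching of [half_edge delta]. *)
  pose Q := [set q : {set half_edge delta} | phi @: q \in val M].
  have imgP p : p \in val M -> p \notin P -> phi @: (phi @^-1: p) = p.
    move=> pM pP; apply/setP => h; apply/imsetP/idP => [[x + ->]|hp].
      by rewrite inE.
    suff /codomP[x hx] : h \in codom phi by exists x; rewrite // inE -hx.
    rewrite -imphi inE; apply: contra pP => /bigcupP[p' pP' hp'].
    by rewrite (M1 _ _ h pM (PM _ pP')).
  have Q_matching : perfect_matching Q.
    apply/perfect_matchingP; split.
    + by move=> q; rewrite inE => /M2; rewrite card_imset.
    + move=> x; have [p pM xp] := covM (phi x).
      exists (phi @^-1: p); rewrite inE // imgP //.
      by apply: contraL xp; apply: phiP.
    + move=> q q' x; rewrite !inE => qM qM' xq xq'; apply: phi_img_inj.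
      by apply: (M1 _ _ (phi x)); rewrite ?imset_f.
  exists (exist _ Q Q_matching); apply/val_inj/setP => p /=.
  rewrite inE; case: (boolP (p \in P)) => [/PM//|pP /=].
  apply/idP/imsetP => [pM|[q + ->]]; last by rewrite inE.
  by exists (phi @^-1: p); rewrite ?inE imgP.
Qed.

(** Group the matchings in [F] by their spilling pairs. Each class is in bijection with the
    matchings of [half_edge delta], compatibly with the remaining graph, so the number of classes
    cancels from the ratio. *)
Lemma core_conditional_law (R : realType) (V : finType) (d : V -> nat)
    (big : pred nat) (A : {set V}) (delta : {ffun remaining A -> nat}) :
  (forall k l, k <= l -> big k -> big l) ->
  let F := [pred M : matching (half_edge d) |
    (~: core big M == A) && (degseq (remove A (config_graph M)) == delta)] in
  Pr R F != 0%R ->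
  forall H : multigraph (remaining A),
    condPr R [pred M : matching (half_edge d) | remove A (config_graph M) == H] F
    = Pr R [pred M : matching (half_edge delta) | config_graph M == H].
Proof.
move=> up F F0 H; pose s (M : matching (half_edge d)) := spilling M (~: A).
(* Used with [pred1 H] for the numerator and [predT] for the denominator. *)
have cardF (P : pred (multigraph (remaining A))) :
    #|[pred M | P (remove A (config_graph M)) & F M]| =
    #|s @: F| * #|[pred Q : matching (half_edge delta) | P (config_graph Q)]|.
  rewrite -[LHS]sum1_card (partition_big s (mem (s @: F))) => [|M /andP[_ FM]]; last first.
    exact: imset_f.
  rewrite -sum_nat_const; apply: eq_bigr => _ /imsetP[M0 FM0 ->].
  case/andP: (FM0) => /eqP cM0 /eqP dM0.
  have [|f [f_inj fG fs]] := @matchings_with_spilling V d A delta M0.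
    by move=> v; rewrite -dM0 degseq_remove.
  rewrite sum1_card -(card_image f_inj); apply: eq_card => M.
  rewrite unfold_in /= /s fs; apply/andP/imageP => [[/andP[PM _] /codomP[Q MQ]]|[Q PQ ->]].
    by exists Q; rewrite // inE -fG -MQ.
  rewrite codom_f unfold_in /= fG; split=> //; apply/andP; split=> //.
  (* The whole class lies in [F]: equal spilling pairs give equal cores and equal remaining
     degrees. *)
  have sQ : spilling M0 (~: A) = spilling (f Q) (~: A).
    by apply/esym/eqP; rewrite fs codom_f.
  rewrite (core_eq_spilling up sQ) -?[in RHS]cM0 ?setCK // eqxx /=.
  apply/eqP/ffunP => v; rewrite -fG degseq_remove -dM0 degseq_remove.
  by rewrite /inner_half_edges sQ.
have := cardF (pred1 H); have := cardF predT.
rewrite (_ : #|[pred M | predT _ & F M]| = #|F|); last exact: eq_card.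
rewrite (_ : #|[pred Q | predT _]| = #|matching (half_edge delta)|); last first.
  exact: eq_card.
move: F0; rewrite /condPr /Pr /= => + cF cH.
rewrite (_ : #|predI [pred M | remove A (config_graph M) == H] F| =
  #|s @: F| * #|[pred M : matching (half_edge delta) | config_graph M == H]|); last first.
  by rewrite -cH; apply: eq_card.
(* [Pr R F != 0] makes the number of classes and both numbers of matchings nonzero. *)
rewrite cF !natrM !mulf_eq0 invr_eq0 !negb_or => /andP[/andP[k0 c0] N0].
by field; rewrite k0 c0 N0.
Qed.

(** * Bound on the removed edges *)

Local Open Scope ring_scope.

Lemma card_spilling_core (R : realDomainType) (K : R) (V : finType) (d : V -> nat)
    (M : matching (half_edge d)) (C := core (fun k => K < k%:R) M) :
  #|spilling M C|%:R <= K * #|~: C|%:R.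
Proof.
have up k l : (k <= l)%N -> K < k%:R -> K < l%:R.
  by move=> kl /lt_le_trans; apply; rewrite ler_nat.
(* Generalised to every [W] containing the core, by induction on the number of vertices still to
   peel; [setT] spills nothing. *)
suff main m (W : {set V}) : C \subset W -> #|W :\: C| = m ->
    #|spilling M C|%:R <= #|spilling M W|%:R + K * m%:R.
  by have := main _ _ (subsetT C) erefl; rewrite spilling_setT cards0 add0r setTD.
elim: m W => [|m IHm] W CW cardW.
  suff -> : W = C by rewrite mulr0 addr0.
  by apply/eqP; rewrite eqEsubset CW andbT -setD_eq0 -cards_eq0 cardW.
(* A set strictly above the core is not dense, so some vertex can be peeled. *)
have /forall_inPn[v vW vsmall] : ~~ dense (fun k => K < k%:R) M W.
  apply/negP => /dense_sub_core; rewrite -setD_eq0 => /eqP W0.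
  by rewrite W0 cards0 in cardW.
have vC : v \notin C by apply: contraNN vsmall => /(core_dense up CW).
have CWv : C \subset W :\ v by rewrite subsetD1 CW.
apply: (le_trans (IHm _ CWv _)).
  by move: cardW; rewrite (cardsD1 v) !inE vC vW !setDDl setUC => -[].
rewrite -natr1 mulrDr mulr1 addrA addrAC lerD2r.
rewrite -leNgt in vsmall; apply: le_trans (lerD (lexx _) vsmall).
by rewrite -natrD ler_nat spilling_setD1.
Qed.

(* Sure bounds for large [n], and the limit *)
From mathcomp Require Import all_classical all_reals all_analysis.

Import numFieldNormedType.Exports.

Local Open Scope classical_set_scope.

Theorem lemma1p3 (R : realType) (d : forall n : nat, 'I_n -> nat)
    (d_gt0 : forall (n : nat) (i : 'I_n), (0 < d n i)%N)
    (D_even : forall n : nat, ~~ odd (total_degree (d n)))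
    (few_small : forall C eps : R, 0 < C -> 0 < eps ->
      exists N : nat, forall n : nat, (N < n)%N ->
        \sum_(i < n)
            ((d n i)%:R < C * Num.sqrt ((total_degree (d n))%:R / n%:R))%R%:R
          <= eps * n%:R)
    (C eps : R) (C_gt0 : 0 < C) (eps_gt0 : 0 < eps) :
  exists S : forall n : nat, matching (half_edge (d n)) -> {set 'I_n},
    (fun n : nat =>
       Pr R [pred M : matching (half_edge (d n)) |
         [&& #|S n M|%:R <= 2 * eps * n%:R,
             (removed_edges (S n M) (config_graph M))%:R
               <= 4 * eps * C * Num.sqrt (n%:R * (total_degree (d n))%:R)
           & [forall v : remaining (S n M),
               C * Num.sqrt ((total_degree (d n))%:R / n%:R)
                 < (degseq (remove (S n M) (config_graph M)) v)%:R]]])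
      @ \oo --> (1 : R)
    /\
    (forall (n : nat) (A : {set 'I_n}) (delta : {ffun remaining A -> nat}),
      let F := [pred M : matching (half_edge (d n)) |
        (S n M == A) && (degseq (remove A (config_graph M)) == delta)] in
      Pr R F != 0 ->
      forall H : multigraph (remaining A),
        condPr R [pred M : matching (half_edge (d n)) |
                    remove A (config_graph M) == H] F
        = Pr R [pred M : matching (half_edge delta) | config_graph M == H]).
Proof.
pose K n : R := C * Num.sqrt ((total_degree (d n))%:R / n%:R).
pose big n : pred nat := fun k => K n < k%:R.
have up n k l : (k <= l)%N -> big n k -> big n l.
  by move=> kl /lt_le_trans; apply; rewrite ler_nat.
exists (fun n M => (~: core (big n) M)%SET); split; last first.
  by move=> n A delta; apply: core_conditional_law; apply: up.
(* A threshold a K with a > 2 would give |S| <= a / (a - 2) eps n; a = 4 yields the required factor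
   2. *)
have [|N few] := few_small (4 * C) eps _ eps_gt0; first by rewrite mulr_gt0.
(* The probability equals 1 as soon as N < n, which also forces n > 0. *)
apply: cvg_near_cst; exists N.+1 => // n /= ltNn; apply/eqP.
have n_gt0 : (0 < n)%N by apply: leq_trans ltNn.
have n0 : (0 : R) < n%:R by rewrite ltr0n.
have D0 : (0 : R) < (total_degree (d n))%:R.
  by rewrite ltr0n /total_degree (bigD1 (Ordinal n_gt0)) //= ltn_addr.
have K0 : 0 < K n by rewrite mulr_gt0 // sqrtr_gt0 divr_gt0.
have sqrt_nD : C * Num.sqrt (n%:R * (total_degree (d n))%:R) = K n * n%:R.
  rewrite /K -mulrA; congr (_ * _).
  have sqrt_n : Num.sqrt (n%:R ^+ 2) = n%:R :> R by rewrite sqrtr_sqr ger0_norm ?ler0n.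
  rewrite -[X in _ = _ * X]sqrt_n -sqrtrM ?divr_ge0 //.
  by congr Num.sqrt; field; rewrite gt_eqF.
suff all_good (M : matching (half_edge (d n))) : let S := (~: core (big n) M)%SET in
    #|S|%:R <= 2 * eps * n%:R /\ #|spilling M (~: S)%SET|%:R <= K n * #|S|%:R.
  rewrite /Pr (_ : #|_| = #|matching (half_edge (d n))|).
    by rewrite divff // pnatr_eq0 -lt0n matching_exists.
  apply: eq_card => M; rewrite !inE /=; have [S_small e_small] := all_good M.
  rewrite S_small removed_edges_config /=; apply/andP; split.
    apply: le_trans e_small _; rewrite -mulrA sqrt_nD.
    have : K n * #|(~: core (big n) M)%SET|%:R <= K n * (2 * eps * n%:R).
      by rewrite ler_pM2l.
    (* The bound obtained is 2 eps K n, half of the allowed 4 eps K n; this sign closes the gap. *)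
    have : 0 <= eps * (K n * n%:R) by rewrite !mulr_ge0 // ltW.
    lra.
  apply/forallP => v; rewrite degseq_remove.
  apply: (core_dense (@up n)); first by rewrite finset.setCK.
  by case: v => v /=; rewrite inE negbK.
move=> S; have e_small : #|spilling M (~: S)%SET|%:R <= K n * #|S|%:R.
  by rewrite finset.setCK; apply: card_spilling_core.
split=> //.
have deg_S : \sum_(i in S) (d n i)%:R <= 2 * #|spilling M (~: S)%SET|%:R :> R.
  by rewrite -natr_sum -natrM ler_nat leq_sum_degrees_spilling.
(* Termwise: d_i >= 4K unless the indicator is 1, in which case the left side vanishes. *)
have : \sum_(i in S) (4 * K n * (1 - ((d n i)%:R < 4 * K n)%R%:R))
    <= \sum_(i in S) (d n i)%:R :> R.
  apply: ler_sum => i _; case: ltP => [_|le4K]; first by rewrite subrr mulr0.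
  by rewrite subr0 mulr1.
rewrite -mulr_sumr sumrB sumr_const.
(* Restricting the sum over all vertices to [S] drops nonnegative terms. *)
have : \sum_(i in S) ((d n i)%:R < 4 * K n)%R%:R <= eps * n%:R.
  apply: le_trans (few n ltNn); rewrite -mulrA.
  by rewrite [leRHS](bigID (mem S)) /= lerDl sumr_ge0.
set t := \sum_(i in S) _; set sd := \sum_(i in S) _ in deg_S *.
(* Everything is multiplied by K > 0, so that 4K(|S| - t) <= 2K|S| and K t <= K eps n combine
   linearly. *)
move=> tle h; suff : K n * #|S|%:R <= K n * (2 * eps * n%:R) by rewrite ler_pM2l.
have : K n * t <= K n * (eps * n%:R) by rewrite ler_pM2l.
lra.
Qed.
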